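(* Let $t>2$ be even, $f=2$ and $d=1$. Consider the strategy in which the lawyer divides the $t$ coins into two piles of size $t/2$, each containing exactly one fake coin, and performs the single weighing comparing the two piles (which balances). This strategy is the least revealing out of any possible strategy for the parameters $(t,2,1)$; that is, its revealing coefficient is at most the revealing coefficient of every strategy for $(t,2,1)$.
   Context: There are $t$ distinguishable coins, identified with a set $T$ with $|T|=t$. All real coins weigh the same, all fake coins weigh the same, and a fake coin is lighter than a real one. Exactly $f$ coins are fake; the lawyer knows the true set $F\subset T$ of fake coins, $|F|=f$. The judge only knows in advance that the number of fake coins is either $f$ or $d$. A weighing places $n\ge 1$ coins on the left pan and $n$ other coins on the right pan of a balance scale; its outcome is one of ''balanced'', ''left pan lighter'', ''right pan lighter'' (the pan with more fake coins is lighter; the pans balance if they contain equally many fake coins). For a finite sequence of weighings performed with true fake set $F$, a set $S\subseteq T$ is consistent if, were $S$ the set of fake coins, every weighing would have the same outcome as it has for $F$. A strategy for $(t,f,d)$ is a choice of $F$ with $|F|=f$ and a finite sequence of weighings that proves to the judge that there are exactly $f$ fake coins, i.e. no set $S$ with $|S|=d$ is consistent. The number of old possibilities is $\binom{t}{f}$; the number of new possibilities of a strategy is the number of consistent sets $S$ with $|S|=f$. The revealing coefficient of a strategy is $R=1-\frac{\#\text{ new possibilities}}{\#\text{ old possibilities}}$; a strategy is less revealing when $R$ is smaller. *)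

(* Defs.v *)
From HB Require Import structures.
From mathcomp Require Import all_boot all_order all_algebra.

Set Implicit Arguments.
Unset Strict Implicit.
Unset Printing Implicit Defensive.

Import GRing.Theory.

Record weighing (T : finType) := Weighing {
  left_pan : {set T};
  right_pan : {set T};
  pans_nonempty : 0 < #|left_pan|;
  pans_same_size : #|left_pan| = #|right_pan|;
  pans_disjoint : [disjoint left_pan & right_pan]
}.

Variant outcome := Balanced | LeftLighter | RightLighter.

Definition outcome_code (o : outcome) : option bool :=
  match o with
  | Balanced => None
  | LeftLighter => Some true
  | RightLighter => Some false
  end.

Definition outcome_decode (c : option bool) : outcome :=
  match c with
  | None => Balanced
  | Some true => LeftLighter
  | Some false => RightLighter
  end.

Lemma outcome_codeK : cancel outcome_code outcome_decode.
Proof. by case. Qed.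

HB.instance Definition _ := Equality.copy outcome (can_type outcome_codeK).

(* The outcome of [w] if [S] were the set of fake coins: the pans hold equally
   many coins and fake coins are lighter, so more fakes means a lighter pan. *)
Definition weigh (T : finType) (w : weighing T) (S : {set T}) : outcome :=
  if #|S :&: right_pan w| < #|S :&: left_pan w| then LeftLighter
  else if #|S :&: left_pan w| < #|S :&: right_pan w| then RightLighter
  else Balanced.

(* The lawyer's choices, not yet required to convince the judge. As the lawyer
   knows the fake coins, the weighings form a fixed sequence. *)
Record plan (T : finType) := Plan {
  fakes : {set T};
  weighings : seq (weighing T)
}.

Definition consistent (T : finType) (s : plan T) (S : {set T}) : bool :=
  all (fun w => weigh w S == weigh w (fakes s)) (weighings s).

Definition is_strategy (T : finType) (f d : nat) (s : plan T) : Prop :=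
  #|fakes s| = f /\ forall S : {set T}, #|S| = d -> ~~ consistent s S.

Definition old_possibilities (t f : nat) : nat := 'C(t, f).

Definition new_possibilities (T : finType) (f : nat) (s : plan T) : nat :=
  #|[set S : {set T} | (#|S| == f) && consistent s S]|.

Definition revealing (T : finType) (f : nat) (s : plan T) : rat :=
  (1 - (new_possibilities f s)%:R / (old_possibilities #|T| f)%:R)%R.

Definition two_pile_plan (T : finType) (w : weighing T) (s : plan T) : Prop :=
  [/\ left_pan w :|: right_pan w = [set: T],
      #|left_pan w| = #|T|./2 /\ #|right_pan w| = #|T|./2,
      #|fakes s :&: left_pan w| = 1 /\ #|fakes s :&: right_pan w| = 1
    & weighings s = [:: w]].

(* Main.v *)
Require Import Defs.
From mathcomp Require Import all_boot all_order all_algebra.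

(** Counting consistent pairs decides the theorem, since the revealing
    coefficient decreases as that number grows. The two-pile weighing balances
    exactly on the pairs with one coin in each pile, so it leaves [(t/2)^2] of
    them, and it excludes every single coin.

    For the optimality, take any strategy that excludes all single fakes. There
    are sets [A] and [D] with [#|A| + #|D| = t] such that every consistent pair
    has one coin in [A] and the other in [D]; by the inequality of the arithmetic
    and geometric means there are then at most [#|A| * #|D| <= (t/2)^2] pairs.

    - If some weighing does not balance, let [A] be its lighter pan and [D] the
      complement of its heavier pan. A pair that makes [A] lighter has a coin in
      [A] and none in the other pan. The sizes add up to [t] because the pans
      have equal sizes ([unbalanced_crossing]).
    - If every weighing balances, each coin must be on a pan at some time, as
      otherwise it could be the only fake. Let [A] be the coins that are on the
      left pan when they are first weighed, and [D] its complement. The coins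
      of a consistent pair always lie on opposite pans or are both off the
      scale, so they are first weighed together and on opposite pans
      ([first_left_split]). *)

(** * Weighings of one or two coins *)

Lemma card_set1I {T : finType} (x : T) (A : {set T}) :
  #|[set x] :&: A| = (x \in A).
Proof.
have [xA|xA] := boolP (x \in A).
  by rewrite (setIidPl _) ?sub1set // cards1.
by apply/eqP; rewrite cards_eq0 setI_eq0 disjoints1.
Qed.

Lemma card_set2I {T : finType} (x y : T) (A : {set T}) : x != y ->
  #|[set x; y] :&: A| = (x \in A) + (y \in A).
Proof.
move=> neq_xy; rewrite setIUl cardsU !card_set1I.
have -> : ([set x] :&: A) :&: ([set y] :&: A) = set0.
  apply/setP=> z; rewrite !inE.
  by case: eqP => // ->; rewrite (negPf neq_xy) andbF.
by rewrite cards0 subn0.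
Qed.

Lemma weigh_balanced {T : finType} (w : weighing T) (S : {set T}) :
  (weigh w S == Balanced) = (#|S :&: left_pan w| == #|S :&: right_pan w|).
Proof. by rewrite /weigh; case: ltngtP. Qed.

Lemma weigh_left {T : finType} (w : weighing T) (S : {set T}) :
  (weigh w S == LeftLighter) = (#|S :&: right_pan w| < #|S :&: left_pan w|).
Proof. by rewrite /weigh; case: ltngtP. Qed.

Lemma weigh_right {T : finType} (w : weighing T) (S : {set T}) :
  (weigh w S == RightLighter) = (#|S :&: left_pan w| < #|S :&: right_pan w|).
Proof. by rewrite /weigh; case: ltngtP. Qed.

Lemma left_notin_right {T : finType} (w : weighing T) (x : T) :
  x \in left_pan w -> x \notin right_pan w.
Proof. by move=> xL; rewrite (disjointFr (pans_disjoint w) xL). Qed.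

Lemma weigh_set1_balanced {T : finType} (w : weighing T) (x : T) :
  (weigh w [set x] == Balanced) = (x \notin left_pan w :|: right_pan w).
Proof.
rewrite weigh_balanced !card_set1I inE.
by case: (boolP (x \in left_pan w)) => [/left_notin_right/negPf-> //|_];
  case: (x \in right_pan w).
Qed.

Lemma weigh_set2_balanced {T : finType} (w : weighing T) (x y : T) : x != y ->
  weigh w [set x; y] == Balanced ->
  (x \in left_pan w) = (y \in right_pan w) /\
  (x \in right_pan w) = (y \in left_pan w).
Proof.
move=> neq_xy; rewrite weigh_balanced !card_set2I //.
case: (boolP (x \in left_pan w)) => [/left_notin_right/negPf->|_];
case: (boolP (y \in left_pan w)) => [/left_notin_right/negPf->|_] //.
- by case: (y \in right_pan w).
- by case: (x \in right_pan w).
- by case: (x \in right_pan w); case: (y \in right_pan w).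
Qed.

(** * Pairs with one coin in each of two sets *)

Definition crossing_pairs {T : finType} (A D : {set T}) : {set {set T}} :=
  [set [set p.1; p.2] | p in setX A D].

Lemma crossing_pairsP {T : finType} (A D S : {set T}) :
  reflect (exists x y, [/\ x \in A, y \in D & S = [set x; y]])
          (S \in crossing_pairs A D).
Proof.
apply: (iffP imsetP) => [[[x y] /=] | [x [y [xA yD ->]]]].
  by rewrite in_setX => /andP[xA yD] ->; exists x, y.
by exists (x, y); rewrite // in_setX xA.
Qed.

Lemma leq_card_crossing {T : finType} (A D : {set T}) :
  #|crossing_pairs A D| <= #|A| * #|D|.
Proof. by rewrite -cardsX leq_imset_card. Qed.

Lemma card_crossing_disjoint {T : finType} (A D : {set T}) :
  [disjoint A & D] -> #|crossing_pairs A D| = #|A| * #|D|.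
Proof.
move=> dis; rewrite -cardsX card_in_imset // => -[x y] [x' y'] /=.
rewrite !in_setX /= => /andP[xA yD] /andP[xA' yD'] eqS.
have : x \in [set x'; y'] by rewrite -eqS set21.
have : y \in [set x'; y'] by rewrite -eqS set22.
rewrite !inE => /orP[/eqP yx'|/eqP->] /orP[/eqP->|/eqP xy'] //.
- by have := disjointFr dis xA'; rewrite -yx' yD.
- by have := disjointFr dis xA'; rewrite -yx' yD.
- by have := disjointFr dis xA; rewrite xy' yD'.
Qed.

(** * Every strategy leaves at most [(t/2)^2] pairs *)

(** An imbalance may leave both coins of a pair in the lighter pan [A]; this is
    why the second set is the complement of the heavier pan [B] and not of [A]. *)
Lemma unbalanced_crossing {T : finType} (A B S : {set T}) :
  [disjoint A & B] -> #|S| == 2 -> #|S :&: B| < #|S :&: A| ->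
  S \in crossing_pairs A (~: B).
Proof.
move=> dis /cards2P[x [y [neq_xy ->]]]; rewrite !card_set2I // => ltBA.
apply/crossing_pairsP.
case: (boolP (x \in A)) ltBA => [xA|_].
  rewrite (disjointFr dis xA) add0n.
  case: (boolP (y \in B)) => [yB|yB _].
    by rewrite (disjointFl dis yB).
  by exists x, y; rewrite inE.
case: (boolP (y \in A)) => [yA|_]; last by rewrite ltn0.
rewrite (disjointFr dis yA) addn0; case: (boolP (x \in B)) => // xB _.
by exists y, x; rewrite inE setUC.
Qed.

(** The coins that are on a left pan the first time that they are weighed: each
    weighing decides for the coins on its pans and leaves the others to the
    weighings that follow. *)
Definition first_left {T : finType} (ws : seq (weighing T)) : {set T} :=
  foldr (fun w A => left_pan w :|: (A :\: right_pan w)) set0 ws.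

(** Balance puts the two coins on opposite pans or both off the scale, so the
    first weighing of one is the first weighing of the other. *)
Lemma first_left_split {T : finType} (ws : seq (weighing T)) (x y : T) :
  x != y -> all (fun w => weigh w [set x; y] == Balanced) ws ->
  has (fun w => x \in left_pan w :|: right_pan w) ws ->
  (x \in first_left ws) = (y \notin first_left ws).
Proof.
move=> neq_xy; elim: ws => //= w ws IH /andP[balw balws].
have [xLyR xRyL] := weigh_set2_balanced w x y neq_xy balw.
rewrite !inE -xLyR -xRyL.
case: (boolP (x \in left_pan w)) => [/left_notin_right/negPf-> //|_].
by case: (boolP (x \in right_pan w)) => //= _; apply: IH.
Qed.

(** Weighings carry no [eqType] structure, so the witness is described by the
    predicates that it satisfies instead of by membership in the sequence. *)
Lemma has_all_witness {X : Type} (a : pred X) (xs : seq X) :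
  has a xs -> exists2 x, a x & forall b : pred X, all b xs -> b x.
Proof.
elim: xs => //= x xs IH /orP[ax|/IH[y ay all_y]].
  by exists x => // b /andP[].
by exists y => // b /andP[_ /all_y].
Qed.

Lemma consistent_pairs_crossing {T : finType} (s : plan T) :
  (forall S : {set T}, #|S| = 1 -> ~~ consistent s S) ->
  exists A D : {set T}, #|A| + #|D| = #|T| /\
    forall S : {set T}, #|S| == 2 -> consistent s S -> S \in crossing_pairs A D.
Proof.
move=> excl1.
have [bal|] := boolP (all (fun w => weigh w (fakes s) == Balanced) (weighings s)).
  have consE S : consistent s S = all (fun w => weigh w S == Balanced) (weighings s).
    rewrite /consistent.
    by elim: (weighings s) bal => //= w ws IH /andP[/eqP-> /IH->].
  exists (first_left (weighings s)), (~: first_left (weighings s)).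
  split=> [|S S2]; first by rewrite cardsC.
  rewrite consE; case/cards2P: S2 => x [y [neq_xy ->]] balS.
  have weighed : has (fun w => x \in left_pan w :|: right_pan w) (weighings s).
    have := excl1 _ (cards1 x); rewrite consE -has_predC.
    by apply: sub_has => w /=; rewrite weigh_set1_balanced negbK.
  have split_xy := first_left_split _ _ _ neq_xy balS weighed.
  apply/crossing_pairsP; have [xA|xA] := boolP (x \in first_left (weighings s)).
    by exists x, y; rewrite inE -split_xy.
  exists y, x; rewrite inE xA setUC; split=> //.
  by move: xA; rewrite split_xy negbK.
rewrite -has_predC => /has_all_witness[w /=].
case Ew: (weigh w (fakes s)) => // _ all_w.
  exists (left_pan w), (~: right_pan w); split=> [|S S2 /all_w].
    by rewrite pans_same_size cardsC.
  by rewrite Ew weigh_left; apply: unbalanced_crossing S2; apply: pans_disjoint.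
exists (right_pan w), (~: left_pan w); split=> [|S S2 /all_w].
  by rewrite -pans_same_size cardsC.
rewrite Ew weigh_right; apply: unbalanced_crossing S2.
by rewrite disjoint_sym; apply: pans_disjoint.
Qed.

Lemma leq_new_possibilities {T : finType} (s : plan T) : ~~ odd #|T| ->
  (forall S : {set T}, #|S| = 1 -> ~~ consistent s S) ->
  new_possibilities 2 s <= #|T|./2 * #|T|./2.
Proof.
move=> evenT /consistent_pairs_crossing[A [D [cardAD sub]]].
have le_AD : new_possibilities 2 s <= #|A| * #|D|.
  apply: leq_trans (leq_card_crossing A D); apply: subset_leq_card.
  by apply/subsetP=> S; rewrite inE => /andP[]; apply: sub.
apply: leq_trans le_AD _; rewrite -(leq_pmul2l (isT : 0 < 4)).
apply: leq_trans (nat_AGM2 _ _) _; rewrite cardAD.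
by rewrite -[X in X ^ 2](even_halfK evenT) -muln2 expnMn mulnC -mulnn.
Qed.

(** * The two-pile weighing *)

Lemma two_pile_balanced {T : finType} (w : weighing T) (s : plan T) :
  two_pile_plan w s -> weigh w (fakes s) = Balanced.
Proof. by case=> _ _ [FL FR] _; apply/eqP; rewrite weigh_balanced FL FR. Qed.

(** The two piles cover all coins, so a single fake coin would tip the scale. *)
Lemma two_pile_strategy {T : finType} (w : weighing T) (s : plan T) :
  two_pile_plan w s -> is_strategy 2 1 s.
Proof.
move=> tp; have bal := two_pile_balanced w s tp.
case: tp => cover _ [FL FR] Ews; split.
  rewrite -[fakes s]setIT -cover setIUr cardsU FL FR setIACA.
  by rewrite (disjoint_setI0 (pans_disjoint w)) setI0 cards0.
move=> S /eqP/cards1P[x ->].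
by rewrite /consistent Ews /= andbT bal weigh_set1_balanced cover inE.
Qed.

Lemma two_pile_new_possibilities {T : finType} (w : weighing T) (s : plan T) :
  two_pile_plan w s -> #|T|./2 * #|T|./2 <= new_possibilities 2 s.
Proof.
move=> tp; have bal := two_pile_balanced w s tp.
case: tp => _ [cardL cardR] _ Ews; have dis := pans_disjoint w.
rewrite -{1}cardL -cardR -(card_crossing_disjoint _ _ dis).
apply/subset_leq_card/subsetP=> _ /crossing_pairsP[x [y [xL yR ->]]].
have neq_xy : x != y.
  by apply: contraTneq xL => ->; rewrite (disjointFl dis yR).
rewrite inE cards2 neq_xy /consistent Ews /= andbT bal weigh_balanced.
by rewrite !card_set2I // xL yR (disjointFr dis xL) (disjointFl dis yR).
Qed.

Lemma two_pile_exists {T : finType} : 2 < #|T| -> ~~ odd #|T| ->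
  exists (w : weighing T) (s : plan T), two_pile_plan w s.
Proof.
move=> T_gt2 evenT; have halfK := even_halfK evenT.
have half_gt0 : 0 < #|T|./2 by rewrite half_gt0 ltnW.
have /card_geqP[r [uniq_r size_r _]] : #|T|./2 <= #|T|.
  by rewrite -{2}halfK -addnn leq_addr.
pose L := [set x in r].
have cardL : #|L| = #|T|./2 by rewrite cardsE (card_uniqP uniq_r).
have cardR : #|~: L| = #|T|./2.
  by rewrite cardsCs setCK cardL -{1}halfK -addnn addnK.
have L_gt0 : 0 < #|L| by rewrite cardL.
have disL : [disjoint L & ~: L] by rewrite -setI_eq0 setICr.
have /card_gt0P[x xL] := L_gt0.
have /card_gt0P[y yR] : 0 < #|~: L| by rewrite cardR.
pose w := Weighing L_gt0 (etrans cardL (esym cardR)) disL.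
exists w, (Plan [set x; y] [:: w]).
have neq_xy : x != y.
  by apply: contraTneq xL => ->; rewrite (disjointFl disL yR).
split=> //=; first by rewrite setUCr.
by rewrite !card_set2I // xL yR (disjointFr disL xL) (disjointFl disL yR).
Qed.

(** * Comparison of revealing coefficients *)

Lemma revealing_antitone {T : finType} (f : nat) (s s' : plan T) :
  new_possibilities f s' <= new_possibilities f s ->
  (revealing f s <= revealing f s')%R.
Proof.
move=> le_new; rewrite /revealing Num.Theory.lerD2l Num.Theory.lerN2.
by rewrite Num.Theory.ler_wpM2r ?Num.Theory.invr_ge0 ?Num.Theory.ler0n
  ?Num.Theory.ler_nat.
Qed.

Theorem theorem6 (T : finType) (t : nat) (cardT : #|T| = t)
    (t_gt2 : 2 < t) (t_even : ~~ odd t) :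
  (exists (w : weighing T) (s : plan T), two_pile_plan w s) /\
  (forall (w : weighing T) (s : plan T), two_pile_plan w s ->
     [/\ weigh w (fakes s) = Balanced,
         is_strategy 2 1 s
       & forall s' : plan T, is_strategy 2 1 s' ->
           (revealing 2 s <= revealing 2 s')%R]).
Proof.
rewrite -cardT in t_gt2 t_even.
split=> [|w s tp]; first exact: two_pile_exists.
split=> [||s' [_ excl1]].
- exact: two_pile_balanced tp.
- exact: two_pile_strategy tp.
apply: revealing_antitone; apply: leq_trans (two_pile_new_possibilities w s tp).
exact: leq_new_possibilities.
Qed.
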